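(* Let $n \ge 5$. A cyclic sequence $s \in \{U,N\}^n$ is realizable if and only if $s$ does not contain three consecutive $U$s.
   Context: A convex polygon $Q$ is inscribed in a convex polygon $C$ if every side of $C$ contains at least one vertex of $Q$. For a convex $n$-gon $C$, let $\mathcal{F}(C)$ denote the family of minimum perimeter convex polygons inscribed in $C$, i.e. those convex polygons $Q$ inscribed in $C$ with $\operatorname{perim}(Q)=\inf\{\operatorname{perim}(Q') : Q' \text{ is inscribed in } C\}$. A cyclic sequence is a sequence $s=(s_1,\dots,s_n)$ whose indices are understood modulo $n$; consecutiveness is understood cyclically. If $C$ has vertices $p_1,\dots,p_n$ in counterclockwise order and $Q$ is inscribed in $C$, the cyclic sequence $s(Q)\in\{U,N\}^n$ associated to $Q$ is defined by: its $k$th element is $U$ if $p_k$ is a vertex of $Q$, and $N$ otherwise. A cyclic sequence $s\in\{U,N\}^n$ is called realizable if there exist a convex $n$-gon $C$ and some $Q\in\mathcal{F}(C)$ such that $s(Q)=s$. *)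

(* Defs.v *)
From mathcomp Require Import all_boot all_order all_algebra.
From mathcomp Require Import classical_sets reals.

Set Implicit Arguments.
Unset Strict Implicit.
Unset Printing Implicit Defensive.

Import Order.TTheory GRing.Theory Num.Theory.
Local Open Scope classical_set_scope.
Local Open Scope ring_scope.

(* The library norm on R * R is the sup norm, hence the explicit formula. *)
Definition dist (R : realType) (a b : R * R) : R :=
  Num.sqrt ((a.1 - b.1) ^+ 2 + (a.2 - b.2) ^+ 2).

(* Positive iff a, b, c make a strict counterclockwise turn. *)
Definition orient (R : realType) (a b c : R * R) : R :=
  (b.1 - a.1) * (c.2 - a.2) - (b.2 - a.2) * (c.1 - a.1).

Definition segment (R : realType) (a b : R * R) : set (R * R) :=
  [set x | exists t : R, [/\ 0 <= t, t <= 1 &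
     x = ((1 - t) * a.1 + t * b.1, (1 - t) * a.2 + t * b.2)]].

(* p lists the vertices of a (nondegenerate) convex polygon in
   counterclockwise order: all vertices other than the endpoints of a side lie
   strictly to the left of that side.  ordS is the cyclic successor on 'I_n, so
   the sides are the segments [p i, p (ordS i)]. *)
Definition convex_polygon (R : realType) (n : nat) (p : 'I_n -> R * R) : Prop :=
  (3 <= n)%N /\
  forall i j : 'I_n, j != i -> j != ordS i -> 0 < orient (p i) (p (ordS i)) (p j).

Definition perim (R : realType) (n : nat) (p : 'I_n -> R * R) : R :=
  \sum_(i < n) dist (p i) (p (ordS i)).

Definition inscribed (R : realType) (n m : nat)
    (C : 'I_n -> R * R) (Q : 'I_m -> R * R) : Prop :=
  convex_polygon Q /\
  forall i : 'I_n, exists j : 'I_m, segment (C i) (C (ordS i)) (Q j).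

Definition inscribed_perims (R : realType) (n : nat) (C : 'I_n -> R * R) : set R :=
  [set x | exists (m : nat) (Q : 'I_m -> R * R), inscribed C Q /\ x = perim Q].

(* Membership of Q in the family F(C). *)
Definition min_inscribed (R : realType) (n m : nat)
    (C : 'I_n -> R * R) (Q : 'I_m -> R * R) : Prop :=
  inscribed C Q /\ perim Q = inf (inscribed_perims C).

Inductive letter : Type := U | N.

(* The cyclic sequence s(Q); indices modulo n are elements of 'I_n. *)
Definition vertex_word (R : realType) (n m : nat)
    (C : 'I_n -> R * R) (Q : 'I_m -> R * R) : 'I_n -> letter :=
  fun k => if [exists j : 'I_m, Q j == C k] then U else N.

Definition realizable (R : realType) (n : nat) (s : 'I_n -> letter) : Prop :=
  exists (C : 'I_n -> R * R) (m : nat) (Q : 'I_m -> R * R),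
    [/\ convex_polygon C, min_inscribed C Q & vertex_word C Q =1 s].

Definition has_three_consecutive_U (n : nat) (s : 'I_n -> letter) : Prop :=
  exists k : 'I_n, [/\ s k = U, s (ordS k) = U & s (ordS (ordS k)) = U].

(* Main.v *)
Require Import Defs.
From mathcomp Require Import all_boot all_order all_algebra.
From mathcomp Require Import classical_sets reals.
From mathcomp Require Import boolp trigo ring lra zify.

(* If three consecutive vertices of C are vertices of Q, then the middle one can be
   dropped from Q: the sides it met are still met by its two neighbours, and the
   perimeter strictly decreases.

   Conversely, let T be a regular m-gon and Q the polygon of the midpoints of its
   sides. Q obeys the reflection law at every side of T, hence it has minimum
   perimeter among the convex polygons meeting all sides of T. Cutting off corners
   of T by a segment that starts at a midpoint keeps part of every side of T, hence
   keeps Q optimal, and turns the chosen midpoints into vertices of C: cutting from a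
   midpoint to the next one produces UU, and cutting from a midpoint to a point
   strictly between the corner and the next midpoint produces a single U. *)

Import Order.TTheory GRing.Theory Num.Theory.
Local Open Scope ring_scope.

(** * Plane geometry *)

Section PlaneGeometry.

Variable R : realType.
Implicit Types (a b c d e o u v w x y : R * R) (t : R).

Definition lerp t a b : R * R :=
  ((1 - t) * a.1 + t * b.1, (1 - t) * a.2 + t * b.2).

Lemma lerp0 a b : lerp 0 a b = a.
Proof. by case: a => a1 a2; rewrite /lerp /= subr0 !mul1r !mul0r !addr0. Qed.

Lemma lerp1 a b : lerp 1 a b = b.
Proof. by case: b => b1 b2; rewrite /lerp /= subrr !mul1r !mul0r !add0r. Qed.

Lemma segment_left a b : segment a b a.
Proof. by exists 0; split=> //; rewrite -[LHS](lerp0 a b). Qed.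

Lemma segment_right a b : segment a b b.
Proof. by exists 1; split=> //; rewrite -[LHS](lerp1 a b). Qed.

Lemma orient_cycle a b c : orient a b c = orient b c a.
Proof. rewrite /orient; ring. Qed.

Lemma orient_swap a b c : orient a c b = - orient a b c.
Proof. rewrite /orient; ring. Qed.

Lemma orient_lerp1 t a b c d :
  orient (lerp t a b) c d = (1 - t) * orient a c d + t * orient b c d.
Proof. rewrite /orient /lerp /=; ring. Qed.

Lemma orient_lerp2 t a b c d :
  orient c (lerp t a b) d = (1 - t) * orient c a d + t * orient c b d.
Proof. rewrite /orient /lerp /=; ring. Qed.

Lemma orient_lerp3 t a b c d :
  orient c d (lerp t a b) = (1 - t) * orient c d a + t * orient c d b.
Proof. rewrite /orient /lerp /=; ring. Qed.

Lemma orient_segment a b x : segment a b x -> orient a b x = 0.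
Proof.
by case=> t [_ _ ->]; rewrite (orient_lerp3 t a b) /orient; ring.
Qed.

Lemma segment_sub a b c d x :
  segment a b c -> segment a b d -> segment c d x -> segment a b x.
Proof.
case=> r [r0 r1 ->] [s [s0 s1 ->]] [t [t0 t1 ->]].
exists ((1 - t) * r + t * s); split; [nra|nra|].
congr pair; rewrite /=; ring.
Qed.

(* The Pluecker relation [ev][uw] = [eu][vw] + [ew][uv] at the base point [o]. *)
Lemma orient_trans o e u v w :
  0 < orient o e u -> 0 < orient o e v -> 0 < orient o e w ->
  0 < orient o u v -> 0 < orient o v w -> 0 < orient o u w.
Proof.
move=> eu ev ew uv vw; rewrite -(pmulr_rgt0 _ ev).
have -> : orient o e v * orient o u w
        = orient o e u * orient o v w + orient o e w * orient o u v.
  by rewrite /orient; ring.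
by rewrite addr_gt0 // mulr_gt0.
Qed.

Definition dot a b : R := a.1 * b.1 + a.2 * b.2.

(** Cauchy-Schwarz: by Lagrange's identity the difference of the squares is the square of a cross
    product. *)
Lemma dot_le_dist u a b :
  dot u u = 1 -> dot u (b.1 - a.1, b.2 - a.2) <= dist a b.
Proof.
rewrite /dot /dist /= => u1.
apply: le_trans (ler_norm _) _; rewrite -sqrtr_sqr ler_wsqrtr //.
rewrite -[leRHS]mul1r -u1 -subr_ge0.
set z := (X in 0 <= X).
suff -> : z = (u.1 * (b.2 - a.2) - u.2 * (b.1 - a.1)) ^+ 2 by exact: sqr_ge0.
by rewrite /z; ring.
Qed.

Lemma dist_ge0 a b : 0 <= dist a b.
Proof. exact: sqrtr_ge0. Qed.

Lemma dist_scale (k : R) u a b : 0 <= k -> dot u u = 1 ->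
  b.1 - a.1 = k * u.1 -> b.2 - a.2 = k * u.2 -> dist a b = k.
Proof.
rewrite /dot /dist => k0 u1 e1 e2.
rewrite -[RHS]ger0_norm // -sqrtr_sqr; congr Num.sqrt.
rewrite -[RHS]mulr1 -u1.
have -> : a.1 - b.1 = - (k * u.1) by rewrite -e1; ring.
have -> : a.2 - b.2 = - (k * u.2) by rewrite -e2; ring.
ring.
Qed.

Lemma dist_triangle_strict a b c :
  orient a b c != 0 -> dist a c < dist a b + dist b c.
Proof.
move=> nz.
rewrite /dist.
set A := (X in Num.sqrt X < _); set B := (X in _ < Num.sqrt X + _).
set C := (X in _ < _ + Num.sqrt X).
have A0 : 0 <= A by rewrite addr_ge0 ?sqr_ge0.
have B0 : 0 <= B by rewrite addr_ge0 ?sqr_ge0.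
have C0 : 0 <= C by rewrite addr_ge0 ?sqr_ge0.
have sB := sqrtr_ge0 B; have sC := sqrtr_ge0 C.
rewrite -(@ltr_pXn2r _ 2) ?nnegrE ?sqrtr_ge0 ?addr_ge0 //.
rewrite sqr_sqrtr // sqrrD !sqr_sqrtr // -sqrtrM //.
pose D := (a.1 - b.1) * (b.1 - c.1) + (a.2 - b.2) * (b.2 - c.2).
have -> : A = B + D *+ 2 + C by rewrite /A /B /C /D; ring.
rewrite ltrD2r ltrD2l ltrMn2r /=.
apply: le_lt_trans (ler_norm _) _; rewrite -sqrtr_sqr ltr_sqrt.
  rewrite -subr_gt0.
  have -> : B * C - D ^+ 2 = orient a b c ^+ 2 by rewrite /B /C /D /orient; ring.
  by rewrite exprn_even_gt0.
have : 0 < orient a b c ^+ 2 by rewrite exprn_even_gt0.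
have -> : orient a b c ^+ 2 = B * C - D ^+ 2 by rewrite /B /C /D /orient; ring.
by move=> h; apply: lt_le_trans h _; rewrite gerBl sqr_ge0.
Qed.

End PlaneGeometry.

Arguments lerp {R} t a b.
Arguments dot {R} a b.

(** * Convex polygons: orientation of vertex triples, rotation of indices, perimeter *)

Lemma val_ordS n (i : 'I_n) : (i.+1 < n)%N -> ordS i = i.+1 :> nat.
Proof. exact: modn_small. Qed.

Section ConvexPolygons.

Variable R : realType.

(** Induction on [k]: with [l] the predecessor of [k], the triples [i, j, l] and [i, l, k] turn
    left, and [orient_trans] at [p i] joins them, the side leaving [p i] being the reference
    direction. *)
Lemma convex_polygon_orient n (p : 'I_n -> R * R) (i j k : 'I_n) :
  convex_polygon p -> (i < j)%N -> (j < k)%N -> 0 < orient (p i) (p j) (p k).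
Proof.
case=> _ cvx.
have side (a x : 'I_n) : (a.+1 < n)%N -> x != a -> x != a.+1 :> nat ->
    forall b : 'I_n, b = a.+1 :> nat -> 0 < orient (p a) (p b) (p x).
  move=> an xa xa1 b ba.
  have -> : b = ordS a by apply: val_inj; rewrite /= ba modn_small.
  by apply: cvx => //; rewrite -val_eqE /= modn_small.
have pred_ord (x : 'I_n) m : x = m.+1 :> nat -> exists y : 'I_n, y = m :> nat.
  by move=> xm; have mn : (m < n)%N by [rewrite ltnW // -xm]; exists (Ordinal mn).
have fan (x : 'I_n) : (i.+1 < x)%N ->
    forall e : 'I_n, e = i.+1 :> nat -> 0 < orient (p i) (p e) (p x).
  move=> ix; apply: side; first exact: ltn_trans (ltn_ord x).
    by rewrite -val_eqE /=; lia.
  lia.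
move Em : (k : nat) => m.
elim: m k Em j => [|m IH] k Ek j ij; first lia.
rewrite ltnS leq_eqVlt => /predU1P[Ej|jm].
  rewrite orient_cycle; apply: side; [|rewrite -val_eqE /=|lia|]; try lia.
  by have := ltn_ord k; lia.
have [l El] := pred_ord _ _ Ek.
have ijl := IH l El j ij jm.
have ilk : 0 < orient (p i) (p l) (p k).
  rewrite orient_cycle; apply: side; try lia; last by rewrite -val_eqE /=; lia.
  by have := ltn_ord k; lia.
have [e Ee] : exists e : 'I_n, e = i.+1 :> nat.
  by have en : (i.+1 < n)%N by [have := ltn_ord j; lia]; exists (Ordinal en).
have [ej|ej] := eqVneq (e : nat) j.
  by have <- : e = j by [exact: val_inj]; apply: fan => //; lia.
apply: (@orient_trans _ _ (p e) _ (p l)) => //; apply: fan; lia.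
Qed.

Lemma orient_convex_polygon n (p : 'I_n -> R * R) :
  (3 <= n)%N ->
  (forall i j k : 'I_n, (i < j)%N -> (j < k)%N -> 0 < orient (p i) (p j) (p k)) ->
  convex_polygon p.
Proof.
move=> n3 cvx; split=> // i j; rewrite -!val_eqE /= => ji.
have [in1|] := ltnP i.+1 n.
  rewrite (modn_small in1) => ji1.
  have [lt_ij|le_ji] := ltnP i j; first by apply: cvx; rewrite ?val_ordS //; lia.
  rewrite -orient_cycle; apply: cvx; rewrite ?val_ordS //; lia.
move=> ni; have Ei : i.+1 = n by have := ltn_ord i; lia.
rewrite Ei modnn => j0; rewrite orient_cycle; apply: cvx => /=.
  by rewrite Ei modnn; lia.
by have := ltn_ord j; lia.
Qed.

Definition rotate_ord {n} (j i : 'I_n) : 'I_n :=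
  Ordinal (ltn_pmod (i + j) (leq_ltn_trans (leq0n i) (ltn_ord i))).

Lemma rotate_ord_bij n (j : 'I_n) : bijective (rotate_ord j).
Proof.
apply: injF_bij => x y /(congr1 val) /= /eqP.
by rewrite eqn_modDr !modn_small // => /eqP /val_inj.
Qed.

Lemma rotate_ordS n (j i : 'I_n) : rotate_ord j (ordS i) = ordS (rotate_ord j i).
Proof.
apply: val_inj; rewrite /= modnDml -addn1 -[(_ %% n).+1]addn1 modnDml.
by congr modn; lia.
Qed.

Lemma convex_polygon_rotate n (p : 'I_n -> R * R) (j : 'I_n) :
  convex_polygon p -> convex_polygon (p \o rotate_ord j).
Proof.
case=> n3 cvx; split=> // i k ki kSi /=; rewrite rotate_ordS.
apply: cvx; first by rewrite (bij_eq (rotate_ord_bij _ j)).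
by rewrite -rotate_ordS (bij_eq (rotate_ord_bij _ j)).
Qed.

Lemma perim_rotate n (p : 'I_n -> R * R) (j : 'I_n) :
  perim (p \o rotate_ord j) = perim p.
Proof.
rewrite /perim [RHS](reindex (rotate_ord j)); last first.
  by apply: onW_bij; exact: rotate_ord_bij.
by apply: eq_bigr => i _ /=; rewrite rotate_ordS.
Qed.

Lemma perimE n (P : nat -> R * R) :
  perim (fun i : 'I_n.+1 => P i) =
  \sum_(i < n) dist (P i) (P i.+1) + dist (P n) (P 0%N).
Proof.
rewrite /perim big_ord_recr /= modnn; congr (_ + _).
by apply: eq_bigr => i _ /=; rewrite modn_small // ltnS.
Qed.

Lemma perim_ge0 n (p : 'I_n -> R * R) : 0 <= perim p.
Proof. by apply: sumr_ge0 => i _; exact: dist_ge0. Qed.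

End ConvexPolygons.

(** * Regular polygons *)

Section RegularPolygon.

Variables (R : realType) (m : nat).

Definition central_angle : R := pi *+ 2 / m%:R.

Definition reg (l : nat) : R * R :=
  (cos (l%:R * central_angle), sin (l%:R * central_angle)).

Let phi := central_angle.

Lemma dot_reg l : dot (reg l) (reg l) = 1.
Proof. by rewrite /dot /= -!expr2 cos2Dsin2. Qed.

Lemma dot_regS l : dot (reg l) (reg l.+1) = cos phi.
Proof.
rewrite /dot /= -cosB -cosN.
by congr cos; rewrite -[l.+1]addn1 natrD /phi; ring.
Qed.

Lemma regSS l :
  (reg l.+2).1 - (reg l).1 = sin phi *+ 2 * - (reg l.+1).2 /\
  (reg l.+2).2 - (reg l).2 = sin phi *+ 2 * (reg l.+1).1.
Proof.
set b := l.+1%:R * phi.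
have Hl : l%:R * phi = b - phi by rewrite /b -[l.+1]addn1 natrD; ring.
have HSS : l.+2%:R * phi = b + phi by rewrite /b -[l.+2]addn1 natrD; ring.
rewrite /reg /= -/phi -/b Hl HSS cosD sinD cosB sinB; split; ring.
Qed.

(** Twice the area of a triangle in the unit circle, by [sin 2x + sin 2y - sin (2x + 2y) = 4 sin x
    sin y sin (x + y)] with [x], [y] half the arcs. *)
Lemma orient_reg a b c : (a <= b)%N -> (b <= c)%N ->
  orient (reg a) (reg b) (reg c) =
  sin ((b - a)%:R * (phi / 2)) * sin ((c - b)%:R * (phi / 2)) *
  sin ((c - a)%:R * (phi / 2)) *+ 4.
Proof.
move=> ab bc.
set x := (b - a)%:R * _; set y := (c - b)%:R * _.
have -> : (c - a)%:R * (phi / 2) = x + y.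
  by rewrite /x /y -mulrDl -natrD; congr (_%:R * _); lia.
have -> : orient (reg a) (reg b) (reg c) =
    sin (x *+ 2) + sin (y *+ 2) - sin (x *+ 2 + y *+ 2).
  have -> : x *+ 2 = b%:R * phi - a%:R * phi by rewrite /x natrB //; field.
  have -> : y *+ 2 = c%:R * phi - b%:R * phi by rewrite /y natrB //; field.
  set u := a%:R * _; set v := b%:R * _; set w := c%:R * _.
  have -> : v - u + (w - v) = w - u by ring.
  by rewrite !sinB /orient /reg /= -/phi -/u -/v -/w; ring.
by rewrite (sinD (x *+ 2) (y *+ 2)) (sinD x y) !cos_mulr2n !sin_mulr2n !cos2sin2; ring.
Qed.

(** Quarter points of the boundary, numbered without reduction modulo [4 * m] so that the cyclic
    order becomes the order of [nat]. Number [4 * l] is a corner and [4 * l + 2] a midpoint. *)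
Definition mark (x : nat) : R * R :=
  lerp ((x %% 4)%:R / 4) (reg (x %/ 4)) (reg (x %/ 4).+1).

Lemma markE l i : (i <= 4)%N -> mark (4 * l + i) = lerp (i%:R / 4) (reg l) (reg l.+1).
Proof.
rewrite leq_eqVlt => /predU1P[->|i4].
  have -> : (4 * l + 4 = 4 * l.+1)%N by lia.
  by rewrite /mark modnMr mulKn // mul0r lerp0 divff ?lerp1 ?pnatr_eq0.
by rewrite /mark mulnC divnMDl // modnMDl divn_small // modn_small // addn0.
Qed.

Lemma mark_segment l x : (4 * l <= x <= 4 * l + 4)%N ->
  segment (reg l) (reg l.+1) (mark x).
Proof.
move=> /andP[lx xl].
have -> : x = (4 * l + (x - 4 * l))%N by lia.
rewrite markE; last lia.
eexists; split; last by [].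
  by rewrite divr_ge0.
by rewrite ler_pdivrMr // mul1r ler_nat; lia.
Qed.

Lemma mark_between l x y z :
  (4 * l <= x)%N -> (x <= y)%N -> (y <= z)%N -> (z <= 4 * l + 4)%N ->
  segment (mark x) (mark z) (mark y).
Proof.
move=> lx xy yz zl.
have [<-|xz] := eqVneq y x; first exact: segment_left.
have Ex : x = (4 * l + (x - 4 * l))%N by lia.
have Ey : y = (4 * l + (y - 4 * l))%N by lia.
have Ez : z = (4 * l + (z - 4 * l))%N by lia.
rewrite Ex Ey Ez !markE; try lia.
set i := (x - _)%N; set j := (y - _)%N; set k := (z - _)%N.
have ij : (i < j)%N by rewrite /i /j; lia.
have jk : (j <= k)%N by rewrite /j /k; lia.
have dij : 0 < j%:R - i%:R :> R by rewrite subr_gt0 ltr_nat.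
have djk : 0 <= k%:R - j%:R :> R by rewrite subr_ge0 ler_nat.
have dik : 0 < k%:R - i%:R :> R by rewrite subr_gt0 ltr_nat; lia.
exists ((j%:R - i%:R) / (k%:R - i%:R)); split.
- by rewrite divr_ge0 ?ltW.
- by rewrite ler_pdivrMr // mul1r; lra.
- by rewrite /lerp /=; congr pair; field; rewrite gt_eqF.
Qed.

(** The squared distance to the centre tells midpoints from all other marks; it will show that an
    [N] is not a vertex of the midpoint polygon. *)
Lemma dot_mark l i : (i <= 4)%N ->
  dot (mark (4 * l + i)) (mark (4 * l + i)) =
  1 - (1 - cos phi) * (i%:R * (4 - i%:R)) / 8.
Proof.
move=> i4; rewrite markE //.
have := dot_reg l; have := dot_reg l.+1; have := dot_regS l.
rewrite /dot /lerp /=; set c := cos _; set c' := cos _; set s := sin _; set s' := sin _.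
move=> <- h' h.
set t := i%:R.
transitivity ((1 - t / 4) ^+ 2 * (c * c + s * s) + (t / 4) ^+ 2 * (c' * c' + s' * s')
  + 2 * (t / 4) * (1 - t / 4) * (c * c' + s * s')); first by field.
by rewrite h h'; field.
Qed.

Hypothesis m_ge3 : (3 <= m)%N.

Let m_gt0 : 0 < m%:R :> R.
Proof. by rewrite ltr0n (leq_trans _ m_ge3). Qed.

Lemma sin_central_angle_gt0 : 0 < sin phi.
Proof.
have m3 : 3 <= m%:R :> R by rewrite ler_nat.
have p0 := pi_gt0 R.
apply: sin_gt0_pi; apply/andP; split.
  by rewrite divr_gt0 // pmulrn_lgt0.
by rewrite /phi /central_angle ltr_pdivrMr // mulr2n; nra.
Qed.

Lemma cos_central_angle_lt1 : cos phi < 1.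
Proof.
rewrite lt_neqAle cos_le1 andbT; apply/eqP => c1.
have := cos2Dsin2 phi; rewrite c1 => h.
have := sin_central_angle_gt0; nra.
Qed.

Lemma reg_periodic l : reg (l + m)%N = reg l.
Proof.
rewrite /reg natrD mulrDl.
have -> : m%:R * central_angle = pi *+ 2.
  by rewrite /central_angle mulrCA divff ?mulr1 // gt_eqF.
by rewrite sinD2pi cosD2pi.
Qed.

Let half_angle_le_pi (k : nat) : (k <= m)%N -> 0 <= k%:R * (phi / 2) <= pi.
Proof.
move=> km.
have -> : k%:R * (phi / 2) = k%:R / m%:R * pi.
  by rewrite /phi /central_angle; field; rewrite gt_eqF.
rewrite mulr_ge0 ?divr_ge0 ?pi_ge0 //= ler_piMl ?pi_ge0 //.
by rewrite ler_pdivrMr // mul1r ler_nat.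
Qed.

Let half_angle_lt_pi (k : nat) : (0 < k < m)%N -> 0 < k%:R * (phi / 2) < pi.
Proof.
move=> /andP[k0 km].
have -> : k%:R * (phi / 2) = k%:R / m%:R * pi.
  by rewrite /phi /central_angle; field; rewrite gt_eqF.
have p0 := pi_gt0 R; have kR : 0 < k%:R :> R by rewrite ltr0n.
apply/andP; split; first by rewrite mulr_gt0 ?divr_gt0.
by rewrite gtr_pMl // ltr_pdivrMr // mul1r ltr_nat.
Qed.

Lemma orient_reg_ge0 a b c : (a <= b)%N -> (b <= c)%N -> (c <= a + m)%N ->
  0 <= orient (reg a) (reg b) (reg c).
Proof.
move=> ab bc cam; rewrite orient_reg // mulrn_wge0 //.
by rewrite !mulr_ge0 // sin_ge0_pi // half_angle_le_pi //; lia.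
Qed.

Lemma orient_reg_gt0 a b c : (a < b)%N -> (b < c)%N -> (c < a + m)%N ->
  0 < orient (reg a) (reg b) (reg c).
Proof.
move=> ab bc cam; rewrite orient_reg ?(ltnW ab) ?(ltnW bc) // pmulrn_lgt0 //.
by rewrite !mulr_gt0 // sin_gt0_pi // half_angle_lt_pi //; lia.
Qed.

Lemma mark_periodic x : mark (x + 4 * m) = mark x.
Proof.
rewrite /mark addnC mulnC divnMDl // modnMDl addnC reg_periodic.
by rewrite -addSn reg_periodic.
Qed.

Let mark_orient_same l i j x : (i < j)%N -> (j <= 4)%N ->
  (4 * l + j < x)%N -> (x < 4 * l + i + 4 * m)%N ->
  ~~ (x <= 4 * l + 4)%N -> ~~ (4 * l + 4 * m <= x)%N ->
  0 < orient (mark (4 * l + i)) (mark (4 * l + j)) (mark x).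
Proof.
move=> ij j4 jx xi x4 xm.
have j0 : 0 < j%:R - i%:R :> R by rewrite subr_gt0 ltr_nat.
rewrite !markE //; last lia.
have -> : orient (lerp (i%:R / 4) (reg l) (reg l.+1))
                 (lerp (j%:R / 4) (reg l) (reg l.+1)) (mark x)
        = (j%:R - i%:R) / 4 * orient (reg l) (reg l.+1) (mark x).
  by rewrite /orient /lerp /=; field.
apply: mulr_gt0; first by rewrite divr_gt0.
have Ex := divn_eq x 4; have k4 : (x %% 4 < 4)%N by rewrite ltn_mod.
rewrite Ex mulnC markE ?(ltnW k4) //.
set X := (x %/ 4)%N in Ex *; set k := (x %% 4)%N in Ex k4 *.
rewrite orient_lerp3.
have k41 : k%:R / 4 < 1 :> R by rewrite ltr_pdivrMr // mul1r ltr_nat.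
have k40 : 0 <= k%:R / 4 :> R by rewrite divr_ge0.
have k41' : 0 < 1 - k%:R / 4 :> R by rewrite subr_gt0.
(* One end of the side of [x] is strictly to the left. If the other is the corner [l.+1], then [x]
   lies past that corner, so the strict end has positive weight. *)
have [EX|X1] := eqVneq X l.+1.
  have o1 : 0 <= orient (reg l) (reg l.+1) (reg X) by apply: orient_reg_ge0; lia.
  have o2 : 0 < orient (reg l) (reg l.+1) (reg X.+1) by apply: orient_reg_gt0; lia.
  have k0 : 0 < k%:R / 4 :> R by rewrite divr_gt0 // ltr0n; lia.
  by apply: ltr_wpDl; [apply: mulr_ge0 => //; exact: ltW|exact: mulr_gt0].
have o1 : 0 < orient (reg l) (reg l.+1) (reg X) by apply: orient_reg_gt0; lia.
have o2 : 0 <= orient (reg l) (reg l.+1) (reg X.+1) by apply: orient_reg_ge0; lia.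
by apply: ltr_pwDl; [exact: mulr_gt0|exact: mulr_ge0].
Qed.

(** The last three hypotheses keep the marks from lying on one closed side. If two of them have the
    same side index, [mark_orient_same] applies; otherwise the orientation is expanded multilinearly
    over corners. *)
Lemma mark_orient a b x : (a < b)%N -> (b < x)%N -> (x < a + 4 * m)%N ->
  (forall l, (4 * l <= a)%N -> (4 * l + 4 < x)%N) ->
  (forall l, (4 * l <= b)%N -> (4 * l + 4 < a + 4 * m)%N) ->
  (forall l, (4 * l <= x)%N -> (4 * l + 4 < b + 4 * m)%N) ->
  0 < orient (mark a) (mark b) (mark x).
Proof.
move=> ab bx xa sa sb sx.
have Ea := divn_eq a 4; have a4 : (a %% 4 < 4)%N by rewrite ltn_mod.
have Eb := divn_eq b 4; have b4 : (b %% 4 < 4)%N by rewrite ltn_mod.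
have Ex := divn_eq x 4; have x4 : (x %% 4 < 4)%N by rewrite ltn_mod.
set A := (a %/ 4)%N in Ea *; set i := (a %% 4)%N in Ea a4 *.
set B := (b %/ 4)%N in Eb *; set j := (b %% 4)%N in Eb b4 *.
set X := (x %/ 4)%N in Ex *; set k := (x %% 4)%N in Ex x4 *.
have sa' := sa A; have sb' := sb B; have sx' := sx X.
have [EAB|nAB] := eqVneq A B.
  have -> : a = (4 * A + i)%N by lia.
  have -> : b = (4 * A + j)%N by lia.
  by apply: mark_orient_same; lia.
have [EBX|nBX] := eqVneq B X.
  rewrite orient_cycle -(mark_periodic a).
  have -> : b = (4 * B + j)%N by lia.
  have -> : x = (4 * B + k)%N by lia.
  by apply: mark_orient_same; lia.
have [EXA|nXA] := eqVneq X (A + m)%N.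
  rewrite -orient_cycle -orient_cycle -orient_cycle -orient_cycle.
  rewrite -(mark_periodic a) -(mark_periodic b).
  have -> : x = (4 * X + k)%N by lia.
  have -> : (a + 4 * m = 4 * X + i)%N by lia.
  by apply: mark_orient_same; lia.
have AB : (A < B)%N by lia.
have BX : (B < X)%N by lia.
have XA : (X < A + m)%N by lia.
have -> : a = (4 * A + i)%N by lia.
have -> : b = (4 * B + j)%N by lia.
have -> : x = (4 * X + k)%N by lia.
clearbody A B X i j k.
clear ab bx xa sa sb sx sa' sb' sx' nAB nBX nXA Ea Eb Ex.
have wt (h : nat) : (h < 4)%N -> 0 <= h%:R / 4 :> R /\ 0 < 1 - h%:R / 4 :> R.
  by move=> h4; rewrite divr_ge0 // subr_gt0 ltr_pdivrMr // mul1r ltr_nat.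
have wi := wt i a4; have wj := wt j b4; have wk := wt k x4.
rewrite !markE ?(ltnW a4) ?(ltnW b4) ?(ltnW x4) //.
rewrite orient_lerp1 !orient_lerp2 !orient_lerp3.
have gt0 (t u v : R) : 0 <= t /\ 0 < 1 - t -> 0 < u -> 0 <= v -> 0 < (1 - t) * u + t * v.
  by case=> t0 t1 u0 v0; rewrite ltr_pwDl ?mulr_gt0 ?mulr_ge0.
have ge0 (t u v : R) : 0 <= t /\ 0 < 1 - t -> 0 <= u -> 0 <= v -> 0 <= (1 - t) * u + t * v.
  by case=> t0 t1 u0 v0; rewrite addr_ge0 ?mulr_ge0 // ltW.
(* The term of the corners [A], [B], [X] is positive with positive weight; the other terms are
   nonnegative. *)
apply: (gt0 _ _ _ wi); first apply: (gt0 _ _ _ wj); first apply: (gt0 _ _ _ wk).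
- by apply: orient_reg_gt0; clear -AB BX XA; lia.
- by apply: orient_reg_ge0; clear -AB BX XA; lia.
- by apply: (ge0 _ _ _ wk); apply: orient_reg_ge0; clear -AB BX XA; lia.
- by apply: (ge0 _ _ _ wj); apply: (ge0 _ _ _ wk); apply: orient_reg_ge0; clear -AB BX XA; lia.
Qed.

(** The last hypothesis puts marks two places apart off any common closed side, which excludes
    collinear triples; the period makes the list go around once. *)
Lemma mark_polygon n (pos : nat -> nat) : (3 <= n)%N ->
  (forall k, (pos k < pos k.+1)%N) ->
  (forall k, pos (k + n)%N = pos k + 4 * m)%N ->
  (forall k l, (4 * l <= pos k)%N -> (4 * l + 4 < pos k.+2)%N) ->
  convex_polygon (fun i : 'I_n => mark (pos i)).
Proof.
move=> n3 incr per gap.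
have mono a b : (a < b)%N -> (pos a < pos b)%N by apply: (homo_ltn ltn_trans incr).
have far a b l : (a.+1 < b)%N -> (4 * l <= pos a)%N -> (4 * l + 4 < pos b)%N.
  move=> ab /gap h; apply: leq_trans h _.
  by move: ab; rewrite leq_eqVlt => /predU1P[<-//|/mono/ltnW].
apply: orient_convex_polygon => // i j k ij jk; have kn := ltn_ord k.
apply: mark_orient; rewrite -?per; try by apply: mono; lia.
- by move=> l; apply: far; lia.
- by move=> l; apply: far; lia.
- by move=> l; apply: far; lia.
Qed.

End RegularPolygon.

(** * Convex polygons meeting all sides of a regular polygon *)

Lemma modn_periodic (T : Type) (F : nat -> T) n k :
  (forall l, F (l + n)%N = F l) -> F (k %% n)%N = F k.
Proof.
move=> per; rewrite [in RHS](divn_eq k n) addnC.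
by elim: (k %/ n)%N => [|q IH]; rewrite ?addn0 // mulSnr addnA per.
Qed.

Section InscribedPerimeters.

Variables (R : realType) (m : nat).

Let phi : R := central_angle R m.
Let c : nat -> R * R := reg R m.

(** The scalar product of [b] with [a] rotated by a quarter turn. *)
Definition cross (a b : R * R) : R := a.1 * b.2 - a.2 * b.1.

Lemma cross_regS l : cross (c l) (c l.+1) = sin phi.
Proof.
rewrite /cross /= mulrC [X in _ - X]mulrC -/(central_angle R m).
have -> : phi = l.+1%:R * phi - l%:R * phi by rewrite -[l.+1]addn1 natrD; ring.
by rewrite sinB; congr (_ * _ - _ * _); rewrite mulrC.
Qed.

Lemma cross_reg_segment l (y : R * R) : segment (c l) (c l.+1) y ->
  cross (c l.+1) y = cross (c l) y - sin phi.
Proof.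
by case=> t [_ _ ->]; rewrite -(cross_regS l) /cross /=; ring.
Qed.

Lemma cross_le_path (P : nat -> R * R) l i j : (i <= j)%N ->
  cross (c l) (P j) - cross (c l) (P i) <= \sum_(i <= k < j) dist (P k) (P k.+1).
Proof.
elim: j => [|j IH]; first by rewrite leqn0 => /eqP ->; rewrite subrr big_geq.
rewrite leq_eqVlt => /predU1P[<-|]; first by rewrite subrr big_geq.
rewrite ltnS => ij; rewrite big_nat_recr //=.
have := IH ij.
have := @dot_le_dist R (- (c l).2, (c l).1) (P j) (P j.+1).
have -> : dot (- (c l).2, (c l).1) (- (c l).2, (c l).1) = 1.
  by rewrite -(dot_reg R m l) /dot /=; ring.
by move=> /(_ erefl); rewrite /dot /cross /=; lra.
Qed.

Hypothesis m_ge3 : (3 <= m)%N.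

(* Up to a quarter turn, [c l.+1] is the direction of the edge of the midpoint
   polygon from side [l] to side [l.+1]. By the reflection law at side [l] the value
   of [cross (c l) - cross (c l.+1)] is constant on that side, so the sum of the
   lower bounds [cross_le_path] over a closed tour does not depend on the tour. *)
Lemma tour_perimeter (P : nat -> R * R) (G : nat -> nat) :
  G 0%N = 0%N -> (forall l, (l < m)%N -> (G l <= G l.+1)%N) ->
  (forall l, (l < m)%N -> segment (c l) (c l.+1) (P (G l))) ->
  P (G m) = P 0%N ->
  m%:R * sin phi <= \sum_(0 <= k < G m) dist (P k) (P k.+1).
Proof.
move=> G0 mono seg PGm.
have tour N : (N <= m)%N ->
    cross (c N) (P (G N)) - cross (c 0) (P (G 0%N)) + N%:R * sin phi
    <= \sum_(0 <= k < G N) dist (P k) (P k.+1).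
  elim: N => [|N IH] Nm; first by rewrite subrr mul0r addr0 G0 big_geq.
  rewrite (@big_cat_nat _ _ _ (G N)) ?mono //=.
  have := IH (ltnW Nm); have := cross_reg_segment N _ (seg N Nm).
  have := cross_le_path P N.+1 _ _ (mono N Nm).
  by rewrite -natr1; lra.
(* After a full tour the direction ([c m = c 0]) and the point are back at their start, so the cross
   terms cancel. *)
have := tour m (leqnn m).
by rewrite PGm G0 -[m in c m]add0n [c _]reg_periodic // subrr add0r.
Qed.

(** Once vertex [0] is on side [0], convexity forces vertices [f l] chosen on the successive sides
    to appear in order, up to visits to vertex [0]. The boundary is then a tour as in
    [tour_perimeter]. *)
Lemma perim_hitting_reg r (Z : 'I_r -> R * R) : convex_polygon Z ->
  (forall l, (l < m)%N -> exists j, segment (c l) (c l.+1) (Z j)) ->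
  m%:R * sin phi <= perim Z.
Proof.
move=> cvxZ hitZ.
have [j0 hit0] := hitZ 0%N (ltn_trans (isT : (0 < 2)%N) m_ge3).
case: r Z cvxZ hitZ j0 hit0 => [|r] Z cvxZ hitZ j0 hit0; first by case: (j0).
rewrite -(perim_rotate _ _ Z j0).
have := convex_polygon_rotate _ _ Z j0 cvxZ.
set W := Z \o _ => cvxW.
have W0 : segment (c 0) (c 1) (W ord0).
  rewrite /W /=; congr (segment _ _ (Z _)) : hit0.
  by apply: val_inj; rewrite /= add0n modn_small.
pose P k := W (inord (k %% r.+1)).
have PE k (kr : (k < r.+1)%N) : P k = W (Ordinal kr).
  by congr W; apply: val_inj; rewrite /= inordK modn_small.
have P0 : P 0%N = W ord0 by rewrite PE; congr W; exact: val_inj.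
have perP : perim W = \sum_(0 <= k < r.+1) dist (P k) (P k.+1).
  rewrite big_mkord; apply: eq_bigr => i _; congr dist.
    by rewrite (PE _ (ltn_ord i)); congr W; apply: val_inj.
  by congr W; apply: val_inj; rewrite /= inordK ?ltn_mod.
have orientP i j k : (i < j)%N -> (j < k)%N -> (k <= r)%N ->
    0 < orient (P i) (P j) (P k).
  move=> ij jk kr.
  have jr : (j < r.+1)%N by lia.
  rewrite (PE _ (ltn_trans ij jr)) (PE _ jr) (PE k kr).
  exact: convex_polygon_orient.
(* The guard [l < m] is inside the existential so that [choice] gives a total [f]. *)
have {hitZ} hitP l : exists k, (l < m)%N ->
    [/\ (k <= r)%N, segment (c l) (c l.+1) (P k) & l = 0%N -> k = 0%N].
  have [->|l0] := eqVneq l 0%N; first by exists 0%N => _; rewrite P0.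
  have [lm|] := ltnP l m; last by exists 0%N.
  have [j hj] := hitZ l lm.
  have [g gK Kg] := rotate_ord_bij _ j0.
  exists (g j) => _; split; [by rewrite -ltnS|rewrite PE|by move=> El; rewrite El in l0].
  rewrite /W /=; have -> : Ordinal (ltn_ord (g j)) = g j by exact: val_inj.
  by rewrite Kg.
have [f fP] := choice hitP.
have f0 : f 0%N = 0%N by have [|_ _ ->] := fP 0%N; first by lia.
(* Sides [2] to [m - 2] are disjoint from side [0], which carries vertex [0]. *)
have fpos b : (2 <= b)%N -> (b.+1 < m)%N -> (0 < f b)%N.
  move=> b2 bm; rewrite lt0n; apply/eqP => fb0.
  have [|_ segb _] := fP b; first by lia.
  move: segb => /orient_segment; rewrite fb0 P0.
  case: W0 => t [t0 t1 ->]; rewrite -/(lerp t (c 0) (c 1)) orient_lerp3.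
  have h0 : 0 < orient (c b) (c b.+1) (c 0).
    by rewrite -[c 0](reg_periodic R m) //; apply: orient_reg_gt0; lia.
  have h1 : 0 < orient (c b) (c b.+1) (c 1).
    by rewrite -[c 1](reg_periodic R m) //; apply: orient_reg_gt0; lia.
  nra.
(* In the wrong order, vertices [0], [f a.+1], [f a] would turn left, whereas points taken from
   sides [0], [a], [a.+1] in this order never turn right. *)
have fmono a : (0 < a)%N -> (a.+1 < m)%N -> (0 < f a.+1)%N -> (f a <= f a.+1)%N.
  move=> a0 am fa1; rewrite leqNgt; apply/negP => lt_f.
  have [|fr sa _] := fP a; first by lia.
  have [|_ sa1 _] := fP a.+1; first by lia.
  have := orientP _ _ _ fa1 lt_f fr.
  rewrite orient_swap oppr_gt0 ltNge => /negP; apply.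
  rewrite P0.
  have ge0 (t p q : R) : 0 <= t -> t <= 1 -> 0 <= p -> 0 <= q -> 0 <= (1 - t) * p + t * q.
    by move=> t0 t1 p0 q0; rewrite addr_ge0 ?mulr_ge0 // subr_ge0.
  case: W0 => t0 [? ? ->]; case: sa => t1 [? ? ->]; case: sa1 => t2 [? ? ->].
  rewrite -!/(lerp _ _ _) orient_lerp1 !orient_lerp2 !orient_lerp3.
  by do 3! (apply: (ge0) => //); apply: orient_reg_ge0; clear -am a0; lia.
(* The tour may come back to its starting vertex already on side [m.-1]; that
   visit has to be numbered [r.+1] instead of [0]. *)
pose G l := if l == m then r.+1 else
  if (f l == 0%N) && (l == m.-1) && (l != 0)%N then r.+1 else f l.
have Pr : P r.+1 = P 0%N by rewrite /P modnn.
have PG l : (l < m)%N -> P (G l) = P (f l).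
  move=> lm; rewrite /G ltn_eqF //; case: ifP => // /andP[/andP[/eqP -> _] _].
  by rewrite Pr.
have Gm : G m = r.+1 by rewrite /G eqxx.
rewrite perP -Gm; apply: tour_perimeter.
- by rewrite /G f0 eqxx andbF; case: ifP => // /eqP; lia.
- move=> l lm; have [|fr _ _] := fP l; first by lia.
  have [El|ml] := eqVneq l.+1 m.
    by rewrite El Gm /G ltn_eqF //; case: ifP => // _; rewrite leqW.
  have [l0|l0] := posnP l.
    rewrite l0 [G 0%N]/G f0 eqxx andbF; case: ifP => // /eqP; lia.
  have {}ml : (l.+1 < m)%N by lia.
  have Gl : G l = f l.
    by rewrite /G ltn_eqF // (_ : l == m.-1 = false) ?andbF //; apply/negbTE; lia.
  rewrite Gl /G ltn_eqF // andbT; case: ifP => [_|/negbT h]; first by rewrite leqW.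
  have [fl0|] := posnP (f l.+1); last exact: fmono.
  by have := fpos l.+1; rewrite fl0 eqxx /= in h *; lia.
- by move=> l lm; rewrite PG //; have [] := fP l lm.
- by rewrite Gm Pr.
Qed.

(** Each edge is half of a chord of [regSS], so its length is [sin phi]. *)
Lemma perim_midpoints : perim (fun i : 'I_m => mark R m (4 * i + 2)) = m%:R * sin phi.
Proof.
rewrite /perim (eq_bigr (fun=> sin phi)) => [|i _].
  by rewrite sumr_const card_ord mulr_natl.
have -> : mark R m (4 * ordS i + 2) = mark R m (4 * i.+1 + 2).
  apply: (@modn_periodic _ (fun k => mark R m (4 * k + 2))) => l.
  by rewrite -[RHS](mark_periodic R m m_ge3); congr mark; lia.
have [e1 e2] := regSS R m i.
rewrite !markE // (@dist_scale _ (sin phi) (- (c i.+1).2, (c i.+1).1)) //.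
- exact/ltW/sin_central_angle_gt0.
- by rewrite -(dot_reg R m i.+1) /dot /=; ring.
- by rewrite /lerp /c /phi /=; rewrite /= mulr2n in e1; lra.
- by rewrite /lerp /c /phi /=; rewrite /= mulr2n in e2; lra.
Qed.

End InscribedPerimeters.

(** * Three consecutive vertices *)

Section Necessity.

Variable R : realType.

Lemma convex_polygon_behead m (W : 'I_m.+4 -> R * R) :
  convex_polygon W -> convex_polygon (W \o lift ord0).
Proof.
move=> cvx; apply: orient_convex_polygon => // i j k ij jk.
by apply: (@convex_polygon_orient _ _ W) => //; rewrite !lift0 ltnS.
Qed.

(** Strict triangle inequality at vertex [0]. *)
Lemma perim_behead m (W : 'I_m.+4 -> R * R) :
  convex_polygon W -> perim (W \o lift ord0) < perim W.
Proof.
move=> cvx; pose P k := W (inord k).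
have -> : W = fun i : 'I_m.+4 => P i by apply: funext => i; rewrite /P inord_val.
have -> : (fun i : 'I_m.+4 => P i) \o lift ord0 = fun i : 'I_m.+3 => P i.+1 by [].
rewrite (perimE _ m.+2 (fun k => P k.+1)) (perimE _ m.+3 P).
rewrite [in ltRHS]big_ord_recl.
pose S := \sum_(i < m.+2) dist (P i.+1) (P i.+2).
change (S + dist (P m.+3) (P 1%N) <
        dist (P 0%N) (P 1%N) + S + dist (P m.+3) (P 0%N)).
have turn : orient (P m.+3) (P 0%N) (P 1%N) != 0.
  rewrite gt_eqF // orient_cycle.
  by apply: convex_polygon_orient; rewrite ?inordK.
have := dist_triangle_strict _ _ _ _ turn.
lra.
Qed.

Lemma realizable_no_UUU n (s : 'I_n -> letter) : (5 <= n)%N ->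
  realizable R s -> ~ has_three_consecutive_U s.
Proof.
move=> n5 [C [m [Q [cvxC [[cvxQ hitQ] minQ] word]]]] [k [sk sk1 sk2]].
have vertex i : s i = U -> exists j, Q j = C i.
  by rewrite -word /vertex_word; case: existsP => // -[j /eqP Ej] _; exists j.
have n0 : (0 < n)%N by lia.
pose r t : 'I_n := Ordinal (ltn_pmod (k + t) n0).
have rS t : ordS (r t) = r t.+1.
  by apply: val_inj; rewrite /= -addn1 modnDml addn1 addnS.
have r0 : r 0%N = k by apply: val_inj; rewrite /= addn0 modn_small.
have r_eq t u : (t < n)%N -> (u < n)%N -> (r t == r u) = (t == u).
  by move=> tn un; rewrite -val_eqE /= eqn_modDl !modn_small.
rewrite -r0 !rS in sk sk1 sk2.
(* Since [n >= 5], the indices [r 0] to [r 4] are distinct, and a corner lies on a side only as its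
   endpoint. *)
have off_side t u : (t < 5)%N -> (u < 4)%N -> t != u -> t != u.+1 ->
    ~ segment (C (r u)) (C (ordS (r u))) (C (r t)).
  move=> t5 u4 tu tu1 /orient_segment /eqP; apply/negP; rewrite gt_eqF //.
  by apply: cvxC.2; rewrite ?rS r_eq //; lia.
have [ja Ea] := vertex _ sk; have [jb Eb] := vertex _ sk1.
have [jd Ed] := vertex _ sk2.
(* The side from [r 3] to [r 4] avoids the three given corners, so it provides a fourth vertex of
   [Q]: a polygon remains after dropping [jb]. *)
have [jx hx] := hitQ (r 3%N).
have neq t u (j j' : 'I_m) : (t < u)%N -> (u < 4)%N ->
    Q j = C (r t) -> Q j' = C (r u) -> j != j'.
  move=> tu u4 Ej Ej'; apply/eqP => jj'.
  apply: (off_side t u); try lia.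
  by rewrite -Ej jj' Ej'; exact: segment_left.
have neqx t (j : 'I_m) : (t < 3)%N -> Q j = C (r t) -> j != jx.
  move=> t3 Ej; apply/eqP => jjx; apply: (off_side t 3%N); try lia.
  by rewrite -Ej jjx.
have jab := neq 0%N 1%N _ _ isT isT Ea Eb.
have jad := neq 0%N 2%N _ _ isT isT Ea Ed.
have jbd := neq 1%N 2%N _ _ isT isT Eb Ed.
(* Only two sides contain the middle corner [C (r 1)], and their far ends [C (r 0)] and [C (r 2)]
   are vertices of [Q]. *)
have hit_other i : exists2 j, j != jb & segment (C i) (C (ordS i)) (Q j).
  have [j hj] := hitQ i; have [Ej|] := eqVneq j jb; last by exists j.
  have [<-|i1] := eqVneq (r 1%N) i.
    exists jd; first by rewrite eq_sym.
    by rewrite Ed rS; exact: segment_right.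
  have [Ei|Si1] := eqVneq (r 1%N) (ordS i).
    exists ja => //; rewrite Ea.
    have -> : i = r 0%N by apply: ordS_inj; rewrite -Ei rS.
    exact: segment_left.
  have := cvxC.2 i (r 1%N) i1 Si1.
  by rewrite orient_segment ?ltxx // -Eb -Ej.
have m4 : (4 <= m)%N.
  have : uniq [:: ja; jb; jd; jx].
    rewrite /= !inE !negb_or jab jad jbd.
    by rewrite (neqx 0%N) // (neqx 1%N) // (neqx 2%N).
  by move=> /card_uniqP /= <-; rewrite -[leqRHS]card_ord max_card.
clear jx hx neqx neq jad jab jbd ja Ea jd Ed vertex word hitQ.
case: m Q cvxQ minQ jb Eb hit_other m4 => [|[|[|[|m]]]] //.
move=> Q cvxQ minQ jb Eb hit_other _.
pose W := Q \o rotate_ord jb.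
have cvxW : convex_polygon W by exact: convex_polygon_rotate.
have : perim (W \o lift ord0) < inf (inscribed_perims C).
  by rewrite -minQ -(perim_rotate _ _ Q jb); exact: perim_behead.
rewrite ltNge => /negP; apply; apply: ge_inf.
  by exists 0 => _ [m' [Q' [_ ->]]]; exact: perim_ge0.
exists m.+3, (W \o lift ord0); split=> //; split; first exact: convex_polygon_behead.
move=> i; have [j jjb hj] := hit_other i.
have [g gK Kg] := rotate_ord_bij _ jb.
have [j'|] := unliftP ord0 (g j).
  by move=> Ej'; exists j'; rewrite /W /= -Ej' Kg.
move=> gj; case/eqP: jjb; rewrite -(Kg j) gj; apply: val_inj.
by rewrite /= add0n modn_small.
Qed.

End Necessity.

(** * Realizing a word *)

Section MarkWord.

Local Open Scope nat_scope.

Variable w : nat -> bool.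

(* The letter at index [k] of the word is [w k.+2], so that its two predecessors
   are available. The word is cut into tokens [N], [UN] and [U] (the last one only
   in front of another [U]); [token k] counts the tokens that end before index [k],
   and the token numbered [l] is responsible for the midpoint [mark (4 * l + 2)]. *)
Fixpoint token (k : nat) : nat :=
  if k is k'.+1 then token k' + ~~ (w k'.+2 && ~~ w k'.+3) else 0.

(* An [N] is a corner of the regular polygon, except for the last letter of [NUN]:
   there the corner is cut off by a segment from the midpoint [U] to the mark next
   to the corner on the following side. *)
Definition offset (k : nat) : nat :=
  if w k.+2 then 2 else if w k.+1 && ~~ w k then 5 else 4.

Definition position (k : nat) : nat := 4 * token k + offset k.

(** Only a [U] before an [N] fails to end a token, and that [N] ends one; so any two consecutive
    letters end at least one token. *)
Lemma token_double k : k <= token k.*2.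
Proof.
elim: k => // k IH; rewrite doubleS /=.
by case: (w k.*2.+2); case: (w k.*2.+3); case: (w k.*2.+4) => /=; lia.
Qed.

Lemma token_onto l : exists k, token k = l.
Proof.
have [k] : exists k, l <= token k by exists l.*2; exact: token_double.
elim: k => [|k IH] /=; first by exists 0; apply/eqP; rewrite eq_sym -leqn0.
have [/IH//|lt_kl] := leqP l (token k).
by move=> le_l; exists k.+1 => /=; move: le_l; case: (_ && _) => /=; lia.
Qed.

(** This will make the midpoint polygon inscribed. A side of [C] with an end lettered [U] has a
    midpoint there; a side between two [N] runs along side [l] across its midpoint. *)
Lemma position_midpoint k : exists l,
  [\/ position k = 4 * l + 2, position k.+1 = 4 * l + 2 |
   [/\ 4 * l <= position k, position k <= 4 * l + 2,
       4 * l + 2 <= position k.+1 & position k.+1 <= 4 * l + 4]].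
Proof.
rewrite /position /offset.
have [U2|N2] := boolP (w k.+2); first by exists (token k); apply: Or31.
exists (token k.+1); have [U3|N3] := boolP (w k.+3); first exact: Or32.
by apply: Or33; rewrite /= (negbTE N2) /=; case: (_ && _); split; lia.
Qed.

Section Periodic.

Variable n : nat.
Hypothesis w_periodic : forall k, w (k + n) = w k.

Lemma token_periodic k : token (k + n) = token k + token n.
Proof.
elim: k => [|k IH] //=.
by rewrite IH -!addSn !w_periodic; lia.
Qed.

Lemma position_periodic k : position (k + n) = position k + 4 * token n.
Proof.
rewrite /position token_periodic /offset -!addSn !w_periodic; lia.
Qed.

(** Two periods contain at least [n] tokens, so [2 * token n >= 5]. *)
Lemma token_ge3 : 5 <= n -> 3 <= token n.
Proof.
move=> n5; have := token_double n; rewrite -addnn token_periodic; lia.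
Qed.

End Periodic.

Hypothesis w_noUUU : forall k, ~~ [&& w k, w k.+1 & w k.+2].

Lemma position_incr k : position k < position k.+1.
Proof.
rewrite /position /offset /=; have := w_noUUU k.
by case: (w k); case: (w k.+1); case: (w k.+2); case: (w k.+3) => //=; lia.
Qed.

(** The tight case is [NUN]: with offset [4] for its last letter the three marks would be collinear,
    and offset [5] passes the corner. *)
Lemma position_gap k l : 4 * l <= position k -> 4 * l + 4 < position k.+2.
Proof.
rewrite /position /offset /=.
have := w_noUUU k; have := w_noUUU k.+1; have := w_noUUU k.+2.
by case: (w k); case: (w k.+1); case: (w k.+2); case: (w k.+3);
  case: (w k.+4) => //=; lia.
Qed.

(** Some side of [C] lies along side [l], so every polygon inscribed in [C] meets side [l]. At a [U]
    a neighbouring [N] supplies it; the middle of [UUU] would keep only the midpoint. The guard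
    [0 < l] guarantees a preceding index. *)
Lemma position_side l : 0 < l ->
  exists k, 4 * l <= position k /\ position k.+1 <= 4 * l + 4.
Proof.
move=> l0.
have atU k : token k = l -> w k.+2 ->
    exists k, 4 * l <= position k /\ position k.+1 <= 4 * l + 4.
  case: k => [|k]; first by move=> /= E; rewrite -E in l0.
  move=> Ek U2; have := w_noUUU k.+2; rewrite U2 /=.
  have [U1|N1] := boolP (w k.+2) => /= N3.
    exists k.+1; move: Ek.
    by rewrite /position /offset /= U2 U1 (negbTE N3) /=; lia.
  exists k; move: Ek.
  by rewrite /position /offset /= U2 (negbTE N1) /=; case: (_ && _); lia.
have [k Ek] := token_onto l.
have [U2|N2] := boolP (w k.+2); first exact: atU Ek U2.
case: k Ek N2 => [|k] Ek N2; first by move: l0; rewrite -Ek.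
have [U1|N1] := boolP (w k.+2).
  by apply: (atU k) => //; move: Ek; rewrite /= U1 N2 /=; lia.
exists k; move: Ek.
rewrite /position /offset /= (negbTE N1) (negbTE N2) /=.
by case: (_ && _); lia.
Qed.

End MarkWord.

(** * The polygon of a word and optimality of its midpoint polygon *)

Section Sufficiency.

Variable R : realType.

Definition isU (x : letter) : bool := if x is U then true else false.

Lemma inf_eq_min (E : set R) x : E x -> lbound E x -> x = inf E.
Proof.
move=> Ex lx; apply/eqP; rewrite eq_le ge_inf ?andbT //; last by exists x.
by apply: lb_le_inf => //; exists x.
Qed.

Lemma no_UUU_realizable n (s : 'I_n -> letter) : (5 <= n)%N ->
  ~ has_three_consecutive_U s -> realizable R s.
Proof.
move=> n5 noUUU; have n0 : (0 < n)%N by lia.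
pose r k : 'I_n := Ordinal (ltn_pmod k n0).
have rS k : ordS (r k) = r k.+1.
  by apply: val_inj; rewrite /= -addn1 modnDml addn1.
have rE (i : 'I_n) : r i = i by apply: val_inj; rewrite /= modn_small.
(* Modulo [n], adding [n - 2] is a shift by [-2], so [w k.+2] is the letter at [k]. *)
pose w k := isU (s (r (k + (n - 2))%N)).
have wE (i : 'I_n) : w i.+2 = isU (s i).
  congr (isU (s _)); apply: val_inj => /=.
  have -> : (i.+2 + (n - 2) = i + n)%N by lia.
  by rewrite modnDr modn_small.
have w_per k : w (k + n)%N = w k.
  by congr (isU (s _)); apply: val_inj => /=; rewrite addnAC modnDr.
have w_noUUU k : ~~ [&& w k, w k.+1 & w k.+2].
  apply/negP => /and3P[]; rewrite /w !addSn -!rS => U0 U1 U2; apply: noUUU.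
  exists (r (k + (n - 2))%N).
  by split; [move: U0|move: U1|move: U2]; case: (s _).
pose m := token w n; pose pos := position w.
have m3 : (3 <= m)%N by exact: token_ge3.
have pos_per k : pos (k + n)%N = (pos k + 4 * m)%N by exact: position_periodic.
pose P := mark R m.
have P_per k : P (pos (k %% n)%N) = P (pos k).
  apply: (@modn_periodic _ (fun k => P (pos k))) => l.
  by rewrite pos_per; exact: mark_periodic.
have q_per l : P (4 * (l %% m)%N + 2)%N = P (4 * l + 2)%N.
  apply: (@modn_periodic _ (fun l => P (4 * l + 2)%N)) => k.
  by rewrite -[RHS](mark_periodic R m m3); congr mark; lia.
pose C (i : 'I_n) := P (pos i).
have Cr k : C (r k) = P (pos k) by exact: P_per.
pose Q (j : 'I_m) := P (4 * j + 2)%N.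
have m0 : (0 < m)%N by lia.
have Qr l : Q (Ordinal (ltn_pmod l m0)) = P (4 * l + 2)%N by exact: q_per.
have cvxC : convex_polygon C.
  apply: (mark_polygon R m m3 n pos) => //; first by lia.
    by move=> k; exact: position_incr.
  by move=> k l; exact: position_gap.
have insQ : inscribed C Q.
  split=> [|i].
    apply: (mark_polygon R m m3 m (fun k => 4 * k + 2)%N) => // *; lia.
  rewrite -(rE i) rS !Cr.
  have [l Hl] := position_midpoint w i.
  exists (Ordinal (ltn_pmod l m0)); rewrite Qr.
  case: Hl => [<-|<-|[? ? ? ?]]; [exact: segment_left|exact: segment_right|].
  exact: (mark_between R m l).
exists C, m, Q; split=> //.
  split=> //; apply: inf_eq_min; first by exists m, Q.
  move=> _ [m' [Q' [[cvxQ' hitQ'] ->]]].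
  rewrite /Q /P perim_midpoints //.
  apply: perim_hitting_reg => // l lm.
  (* Side [l + m] is side [l] one turn later, with the positive number that [position_side]
     requires. *)
  have [|k [lk kl]] := @position_side w w_noUUU (l + m)%N; first by lia.
  have kk := position_incr w w_noUUU k.
  have [j hj] := hitQ' (r k); exists j; move: hj; rewrite rS !Cr.
  rewrite -(reg_periodic R m m3 l) -(reg_periodic R m m3 l.+1) addSn.
  by apply: segment_sub; apply: mark_segment => //; rewrite -/pos in lk kl kk *; lia.
move=> i; rewrite /vertex_word; case: existsP => [[j /eqP Qj]|noj].
  suff : isU (s i) by case: (s i).
  rewrite -wE; apply/negPn/negP => Ni.
  have c1 := cos_central_angle_lt1 R m m3.
  move/(congr1 (fun x => dot x x)): Qj.
  rewrite /Q /C /P /pos /position /offset (negbTE Ni) dot_mark //.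
  case: ifP => _; last by rewrite dot_mark //; lra.
  (* Offset [5] exceeds the range of [dot_mark]; it is quarter [1] of the next side. *)
  have -> : (4 * token w i + 5 = 4 * (token w i).+1 + 1)%N by lia.
  by rewrite dot_mark //; lra.
have [Ui|] := boolP (w i.+2); last by rewrite wE; case: (s i).
case: noj; exists (Ordinal (ltn_pmod (token w i) m0)); apply/eqP.
by rewrite Qr /C /pos /position /offset Ui.
Qed.

End Sufficiency.

Theorem theorem4 (R : realType) (n : nat) (hn : (5 <= n)%N) (s : 'I_n -> letter) :
  realizable R s <-> ~ has_three_consecutive_U s.
Proof.
by split; [exact: realizable_no_UUU|exact: no_UUU_realizable].
Qed.
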